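(* For any $\lambda\neq0$ and any $\mu\in\mathbb R$, one has $$\sigma_j^m(\lambda u_h+\mu)=\sigma_j^m(u_h),$$ which implies $$\mathcal F_\tau(\lambda u_h+\mu)=\lambda\mathcal F_\tau(u_h)+\mu .$$
   Context: Consider a one-dimensional scalar conservation law $u_t+f(u)_x=0$ on a spatial domain $\Omega=\bigcup_jI_j$ partitioned into cells $I_j=[x_{j-1/2},x_{j+1/2}]$ of length $h_j$. Let $\mathbb V^k=\{v\in L^2(\Omega):v|_{I_j}\in\mathbb P^k(I_j)\ \forall j\}$, where $\mathbb P^k(I_j)$ is the space of polynomials of degree $\le k$ on $I_j$, and let $u_h\in\mathbb V^k$. $[\![v]\!]_{j+1/2}=v^+_{j+1/2}-v^-_{j+1/2}$ is the jump of $v$ at $x_{j+1/2}$ (right limit minus left limit), derivatives $\partial_x^m u_h$ are taken cellwise, and $\mathrm{avg}(v)=\frac1{|\Omega|}\int_\Omega v\,dx$. Damping coefficient (for $0\le m\le k$ and each cell $I_j$): $\sigma_j^m(u_h)=0$ if $u_h\equiv\mathrm{avg}(u_h)$; otherwise $$\sigma_j^m(u_h)=\frac{(2m+1)h_j^m}{(2k-1)\,m!}\,\frac{|[\![\partial_x^mu_h]\!]_{j-1/2}|+|[\![\partial_x^mu_h]\!]_{j+1/2}|}{2\|u_h-\mathrm{avg}(u_h)\|_{L^\infty(\Omega)}} .$$ Oscillation-eliminating (OE) operator: let $P^m$ be the standard $L^2$ projection onto $\mathbb V^m$ for $m\ge0$ and $P^{-1}:=P^0$. For a time step size $\tau$,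 the operator $\mathcal F_\tau:\mathbb V^k\to\mathbb V^k$ is defined by $\mathcal F_\tau u_h=u_\sigma(\cdot,\tau)$, where $u_\sigma(\cdot,\hat t)\in\mathbb V^k$ (with $\hat t$ a pseudo-time) solves, on each $I_j$, $$\frac{d}{d\hat t}\int_{I_j}u_\sigma v\,dx+\sum_{m=0}^k\beta_j\frac{\sigma_j^m(u_h)}{h_j}\int_{I_j}(u_\sigma-P^{m-1}u_\sigma)v\,dx=0\quad\forall v\in\mathbb P^k(I_j),\qquad u_\sigma(\cdot,0)=u_h .$$ Here $\beta_j$ is a suitable estimate of the local maximum wave speed on $I_j$; for scalar conservation laws it is taken as $\beta_j=|f'(\overline u_j)|$, where $\overline u_j$ is the cell average over $I_j$ of the function $u_h$ to which $\mathcal F_\tau$ is applied.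
   Formalization: As β_j=|f'(ū_j)| depends on the argument of F_τ, the second identity fails for nonlinear f; it is proved for β_j held fixed, for equal β_j on both sides, or with flux λf((w-μ)/λ) for λu_h+μ. Jumps at the ends of Ω are periodic or zero. *)

(* Defs.v *)
From HB Require Import structures.
From mathcomp Require Import all_boot all_order all_algebra.
From mathcomp Require Import all_classical all_reals all_analysis.

Set Implicit Arguments.
Unset Strict Implicit.
Unset Printing Implicit Defensive.
Import Order.TTheory GRing.Theory Num.Theory.
Import numFieldNormedType.Exports.

Local Open Scope classical_set_scope.
Local Open Scope ring_scope.

(* Cells are numbered from 0: cell j is I_j = [node j, node j.+1], so that
   node j plays the role of x_{j-1/2} and node j.+1 that of x_{j+1/2}. *)
Record mesh (R : realType) := Mesh {
  ncells : nat;
  node : nat -> R;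
  ncells_gt0 : (0 < ncells)%N;
  node_lt : forall j, (j < ncells)%N -> node j < node j.+1 }.

(* How the outer boundary of the domain is treated when forming jumps: the
   first and last cells are neighbours, or no exterior trace is available and
   the jumps at the two end points of the domain are zero. *)
Inductive boundary := Periodic | ZeroJump.

Section DG.
Context {R : realType}.
Local Notation mu := (@lebesgue_measure R).

Section Mesh.
Variable M : mesh R.
Local Notation cell := 'I_(ncells M).

Definition left_end (j : cell) : R := node M j.
Definition right_end (j : cell) : R := node M j.+1.
Definition h (j : cell) : R := right_end j - left_end j.
Definition domain : set R := `[node M 0, node M (ncells M)]%classic.

Definition cell_int (j : cell) (p : {poly R}) : R :=
  (\int[mu]_(x in `[left_end j, right_end j]%classic) p.[x])%R.

(* The space V^k. An element is determined by its polynomial on each cell, in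
   the global coordinate x; values at the nodes are irrelevant in L^2. *)
Definition dgfun (k : nat) := {ffun cell -> {poly_k.+1 R}}.

End Mesh.

Variables (M : mesh R) (bc : boundary).
Local Notation cell := 'I_(ncells M).

(* A representative of v on the real line, extended by 0 outside the domain *)
Definition dg_eval k (v : dgfun M k) (x : R) : R :=
  \sum_(j < ncells M)
    \1_(`[left_end j, right_end j[%classic) x * (v j : {poly R}).[x].

Definition dg_cst k (c : R) : dgfun M k := [ffun=> npolyp k.+1 c%:P].

Definition avg k (v : dgfun M k) : R :=
  (\int[mu]_(x in domain M) dg_eval v x)%R / (node M (ncells M) - node M 0).

Definition cell_avg k (v : dgfun M k) (j : cell) : R :=
  cell_int j (v j) / h j.

Definition Linfty_norm k (v : dgfun M k) : R :=
  fine ('N[mu]_+oo[EFin \o dg_eval v])%E.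

(* Trace of the m-th cellwise derivative from the cell r on the right of an
   interface minus its trace from the cell l on the left. Each trace is taken
   at the end point of its own cell, because in the periodic case these two
   points may be the two ends of the domain. *)
Definition jump k (v : dgfun M k) (m : nat) (l r : cell) : R :=
  ((v r : {poly R})^`(m)).[left_end r] - ((v l : {poly R})^`(m)).[right_end l].

(* [ord_pred] and [ordS] are cyclic, hence the test for the end cells. *)
Definition jump_left k (v : dgfun M k) (m : nat) (j : cell) : R :=
  match bc with
  | Periodic => jump v m (ord_pred j) j
  | ZeroJump => if (0 < j)%N then jump v m (ord_pred j) j else 0
  end.

Definition jump_right k (v : dgfun M k) (m : nat) (j : cell) : R :=
  match bc with
  | Periodic => jump v m j (ordS j)
  | ZeroJump => if (j.+1 < ncells M)%N then jump v m j (ordS j) else 0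
  end.

Definition sigma k (u : dgfun M k) (m : nat) (j : cell) : R :=
  if u == dg_cst k (avg u) then 0
  else ((2 * m + 1)%:R * h j ^+ m) / ((2 * k%:R - 1) * (m`!)%:R)
       * ((`|jump_left u m j| + `|jump_right u m j|)
          / (2 * Linfty_norm (u - dg_cst k (avg u)))).

Definition is_L2proj k m (v : dgfun M k) (q : dgfun M m) : Prop :=
  forall w : dgfun M m,
    (\int[mu]_(x in domain M) ((dg_eval v x - dg_eval q x) * dg_eval w x))%R
    = 0.

Definition L2proj k m (v : dgfun M k) : dgfun M m :=
  xget 0 [set q | is_L2proj v q].

(* [us] solves the damping problem on the pseudo-time interval [0, tau] with
   datum u and local wave speeds beta. Since m.-1 = 0 for m = 0, the convention
   P^{-1} = P^0 is built in. *)
Definition OE_solution k (beta : cell -> R) (tau : R) (u : dgfun M k)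
    (us : R -> dgfun M k) : Prop :=
  us 0 = u /\
  forall (j : cell) (v : {poly_k.+1 R}),
    {within `[0, tau]%classic,
       continuous (fun t => cell_int j ((us t j : {poly R}) * v))} /\
    forall t, 0 < t < tau ->
      is_derive t (1 : R) (fun s => cell_int j ((us s j : {poly R}) * v))
        (- \sum_(0 <= m < k.+1) beta j * (sigma u m j / h j) *
             cell_int j
               (((us t j : {poly R}) - (L2proj m.-1 (us t) j : {poly R})) * v)).

(* The operator F_tau, for given local wave speeds beta *)
Definition OE k (beta : cell -> R) (tau : R) (u : dgfun M k) : dgfun M k :=
  xget 0 [set w | exists2 us, OE_solution beta tau u us & us tau = w].

Definition wave_speed k (f : R -> R) (u : dgfun M k) (j : cell) : R :=
  `|derive1 f (cell_avg u j)|.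

(* The operator F_tau of the scalar conservation law with flux f *)
Definition OE_flux k (f : R -> R) (tau : R) (u : dgfun M k) : dgfun M k :=
  OE (wave_speed f u) tau u.

End DG.

(* If w solves w_t + f(w)_x = 0, then lam w + c solves the conservation law
   with this flux. *)
Definition affine_flux (R : realType) (lam c : R) (f : R -> R) : R -> R :=
  fun w => lam * f ((w - c) / lam).

(* Main.v *)
Require Import Defs.
From HB Require Import structures.
From mathcomp Require Import all_boot all_order all_algebra.
From mathcomp Require Import all_classical all_reals all_analysis.
From mathcomp Require Import finmap ess_sup_inf ring.
Import Order.TTheory GRing.Theory Num.Theory.
Import numFieldNormedType.Exports.
Local Open Scope ring_scope.
Set Implicit Arguments.
Unset Strict Implicit.
Unset Printing Implicit Defensive.

(* On each cell, expand in the orthogonal polynomials of the L^2 product. The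
   projection P^{m-1} keeps exactly the modes of degree at most max(m-1, 0), so
   the damping problem decouples: mode i is multiplied by exp(-r_i tau), where
   r_i collects the coefficients with max(m-1, 0) < i and depends on the datum
   only through sigma. In particular r_0 = 0. Hence F_tau is given by a formula
   which, the rates being fixed, is linear in the datum and fixes constants;
   and sigma is invariant because jumps and the L^infinity norm of u - avg u
   are both unchanged by adding constants and scale by |lambda|. *)

(** * Orthogonal polynomials of a definite bilinear form L(pq) *)

Section OrthogonalPolynomials.
Context {F : fieldType} (L : {scalar {poly F}}).
Implicit Types p q : {poly F}.

Definition proj_along (e p : {poly F}) : {poly F} :=
  (L (p * e) / L (e * e)) *: e.

(** Step [n] of Gram-Schmidt needs all earlier polynomials; carrying them in a list keeps the
    recursion structural. *)
Fixpoint orthopolys (n : nat) : seq {poly F} :=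
  if n is n'.+1 then
    let s := orthopolys n' in
    rcons s ('X^n' - \sum_(e <- s) proj_along e 'X^n')
  else [::].

(** Gram-Schmidt applied to the monomials, without normalization. For [cell_int j] these are the
    monic Legendre polynomials transported to the cell. *)
Definition orthopoly n := 'X^n - \sum_(e <- orthopolys n) proj_along e 'X^n.

Definition mode n p := proj_along (orthopoly n) p.

Lemma orthopolysE n : orthopolys n = [seq orthopoly i | i <- iota 0 n].
Proof.
by elim: n => // n IHn; rewrite -[in RHS]addn1 iotaD map_cat -IHn cats1.
Qed.

Lemma orthopolyE n : orthopoly n = 'X^n - \sum_(i < n) mode i 'X^n.
Proof.
by rewrite /orthopoly orthopolysE big_map -[X in iota _ X]subn0 big_mkord.
Qed.

Lemma mode_is_linear n : linear (mode n).
Proof.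
move=> a p q; rewrite /mode /proj_along mulrDl -scalerAl linearP /=.
by rewrite mulrDl scalerDl scalerA mulrA.
Qed.

HB.instance Definition _ n :=
  GRing.isLinear.Build F {poly F} {poly F} _ (mode n) (mode_is_linear n).

Lemma mode_mulL n p q :
  L (mode n p * q) = L (p * orthopoly n) * L (orthopoly n * q)
                     / L (orthopoly n * orthopoly n).
Proof. by rewrite -scalerAl linearZ /= mulrAC. Qed.

Lemma size_orthopoly n : size (orthopoly n) = n.+1.
Proof.
elim/ltn_ind: n => n IHn; rewrite orthopolyE size_polyDl ?size_polyXn//.
rewrite size_polyN ltnS; apply: leq_trans (size_sum _ _ _) _.
apply/bigmax_leqP => i _; apply: leq_trans (size_scale_leq _ _) _.
by rewrite IHn.
Qed.

Lemma orthopoly_neq0 n : orthopoly n != 0.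
Proof. by rewrite -size_poly_eq0 size_orthopoly. Qed.

Hypothesis L_definite : forall p, L (p * p) = 0 -> p = 0.

Let norm_neq0 n : L (orthopoly n * orthopoly n) != 0.
Proof. by apply: contra (orthopoly_neq0 n) => /eqP/L_definite ->. Qed.

(** By strong induction on the larger index [i]: the subtracted mode [j] cancels the component of
    ['X^i] along [orthopoly j], and every other subtracted mode has index below [i], so the
    induction hypothesis applies to it. *)
Lemma orthopoly_orthogonal i j : i != j -> L (orthopoly i * orthopoly j) = 0.
Proof.
wlog ji : i j / (j < i)%N => [hw|].
  move=> ij; case: (ltngtP i j) (ij) => [lt_ij _|lt_ji _|//].
    by rewrite mulrC hw// eq_sym.
  exact: hw.
move=> _; elim/ltn_ind: i j ji => i IHi j ji.
rewrite {1}orthopolyE mulrBl linearB /= mulr_suml linear_sum /=.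
rewrite (bigD1 (Ordinal ji))//= mode_mulL mulfK// big1 ?addr0 ?subrr// => l lj.
rewrite mode_mulL (_ : L (orthopoly l * orthopoly j) = 0) ?mulr0 ?mul0r//.
have {}lj : nat_of_ord l != j by apply: contra lj => /eqP lj; apply/eqP/val_inj.
case: ltngtP lj => // lj _; last by rewrite IHi.
by rewrite mulrC IHi.
Qed.

Lemma mode_orthogonal i p j : i != j -> L (mode i p * orthopoly j) = 0.
Proof. by move=> ij; rewrite mode_mulL orthopoly_orthogonal// mulr0 mul0r. Qed.

Lemma mode_orthopoly i p : L (mode i p * orthopoly i) = L (p * orthopoly i).
Proof. by rewrite mode_mulL mulfK. Qed.

(** Arbitrary weights serve two uses: all weights 1 give a truncation, exponential weights give the
    damped solution. *)
Lemma sum_mode_orthopoly n (c : nat -> F) p i :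
  L ((\sum_(l < n) c l *: mode l p) * orthopoly i) =
  (if (i < n)%N then c i * L (p * orthopoly i) else 0).
Proof.
rewrite mulr_suml linear_sum /=.
under eq_bigr do rewrite -scalerAl linearZ /=.
case: ifPn => ni; last first.
  rewrite big1// => l _; rewrite mode_orthogonal ?mulr0//.
  by apply: contraNneq ni => <-.
rewrite (bigD1 (Ordinal ni))//= mode_orthopoly big1 ?addr0// => l li.
rewrite mode_orthogonal ?mulr0//; apply: contra li => /eqP li.
Qed.

(** Removing the multiple of [orthopoly n] that matches the top coefficient leaves a polynomial of
    lower degree, zero by induction. Testing what remains against [orthopoly n] kills the multiple
    too. *)
Lemma eq0_orthopoly n p : (size p <= n)%N ->
  (forall i, (i < n)%N -> L (p * orthopoly i) = 0) -> p = 0.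
Proof.
have nz l : lead_coef (orthopoly l) != 0.
  by rewrite lead_coef_eq0 orthopoly_neq0.
elim: n p => [|n IHn] p sp hp; first by apply/eqP; rewrite -size_poly_leq0.
pose a := p`_n / lead_coef (orthopoly n).
pose r := p - a *: orthopoly n.
have sr : (size r <= n)%N.
  apply/leq_sizeP => l; rewrite leq_eqVlt => /predU1P[<-|nl].
    rewrite coefB coefZ /a lead_coefE size_orthopoly/= divfK ?subrr//.
    by have := nz n; rewrite lead_coefE size_orthopoly.
  rewrite coefB coefZ !nth_default ?mulr0 ?subr0// ?size_orthopoly//.
  exact: leq_trans sp nl.
have r0 : r = 0.
  apply: IHn => // i ni; rewrite mulrBl linearB /= hp ?ltnS 1?ltnW//.
  rewrite -scalerAl linearZ /= orthopoly_orthogonal ?mulr0 ?subr0//.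
  by rewrite gtn_eqF.
move/eqP: (r0); rewrite subr_eq0 => /eqP pE.
have := hp n (ltnSn n); rewrite pE -scalerAl linearZ /= => /eqP.
by rewrite mulf_eq0 (negPf (norm_neq0 n)) orbF => /eqP ->; rewrite scale0r.
Qed.

Lemma eq_orthopoly n p q : (size p <= n)%N -> (size q <= n)%N ->
  (forall i, (i < n)%N -> L (p * orthopoly i) = L (q * orthopoly i)) -> p = q.
Proof.
move=> sp sq pq; apply/eqP; rewrite -subr_eq0; apply/eqP.
apply: (@eq0_orthopoly n) => [|i ni]; last first.
  by rewrite mulrBl linearB /= pq ?subrr.
by rewrite (leq_trans (size_polyD _ _))// size_polyN geq_max sp.
Qed.

Lemma size_sum_mode n (c : nat -> F) p :
  (size (\sum_(i < n) c i *: mode i p)%R <= n)%N.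
Proof.
apply: leq_trans (size_sum _ _ _) _; apply/bigmax_leqP => i _.
apply: leq_trans (size_scale_leq _ _) _.
by apply: leq_trans (size_scale_leq _ _) _; rewrite size_orthopoly.
Qed.

Definition trunc n p := \sum_(i < n) mode i p.

Let truncE n p : trunc n p = \sum_(i < n) 1 *: mode i p.
Proof. by apply: eq_bigr => i _; rewrite scale1r. Qed.

Lemma size_trunc n p : (size (trunc n p) <= n)%N.
Proof. by rewrite truncE (size_sum_mode _ (fun=> 1)). Qed.

Lemma trunc_orthopoly n p i : (i < n)%N ->
  L (trunc n p * orthopoly i) = L (p * orthopoly i).
Proof.
by move=> ni; rewrite truncE (sum_mode_orthopoly _ (fun=> 1)) ni mul1r.
Qed.

(** Both sides have size at most [n] and the same products with the first [n] orthogonal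
    polynomials. *)
Lemma trunc_id n p : (size p <= n)%N -> trunc n p = p.
Proof.
move=> sp; apply: (@eq_orthopoly n) => // [|i ni]; first exact: size_trunc.
exact: trunc_orthopoly.
Qed.

(** Such a [p] is the sum of its modes below [i], and these are all orthogonal to [orthopoly i]. *)
Lemma mode_low_degree i p : (size p <= i)%N -> mode i p = 0.
Proof.
move=> sp; rewrite /mode /proj_along -{1}(trunc_id sp) truncE.
by rewrite (sum_mode_orthopoly _ (fun=> 1)) ltnn mul0r scale0r.
Qed.

Lemma orthogonal_low_degree n p q : (size q <= n)%N ->
  (forall i, (i < n)%N -> L (p * orthopoly i) = 0) -> L (p * q) = 0.
Proof.
move=> /trunc_id <- hp; rewrite mulr_sumr linear_sum big1// => i _.
by rewrite -scalerAr linearZ /= hp// mulr0.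
Qed.

End OrthogonalPolynomials.

(** * The L^2 product on a cell *)

Lemma integrable_horner (R : realType) (a b : R) (p : {poly R}) :
  (@lebesgue_measure R).-integrable `[a, b]%classic (EFin \o horner p).
Proof.
apply: continuous_compact_integrable; first exact: segment_compact.
exact/continuous_subspaceT/continuous_horner.
Qed.

Lemma finite_roots (R : idomainType) (p : {poly R}) :
  p != 0 -> finite_set [set x | root p x].
Proof.
move=> p0; apply: contrapT => /(infinite_set_fset (size p))[B Bp sB].
suff /(max_poly_roots p0)/(_ (fset_uniq B)) : all (root p) B.
  by rewrite ltnNge sB.
by apply/allP => x xB; exact: Bp.
Qed.

Section Cells.
Context {R : realType} (M : mesh R).
Local Notation cell := 'I_(ncells M).
Local Notation mu := (@lebesgue_measure R).
Implicit Types (j : cell) (p : {poly R}).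

Lemma left_lt_right j : left_end j < right_end j.
Proof. exact: node_lt. Qed.

Lemma h_gt0 j : 0 < h j.
Proof. by rewrite subr_gt0 left_lt_right. Qed.

Lemma cell_int_is_linear j : scalar (cell_int j).
Proof.
move=> a p q; rewrite /cell_int.
under eq_Rintegral do rewrite hornerD hornerZ.
rewrite RintegralD ?RintegralZl//; try exact: integrable_horner.
rewrite (_ : _ \o _ = (fun x => a%:E * (EFin \o horner p) x)%E)//.
by apply: integrableZl => //; exact: integrable_horner.
Qed.

HB.instance Definition _ j :=
  GRing.isLinear.Build R {poly R} R _ (cell_int j) (cell_int_is_linear j).

Lemma cell_intC j (c : R) : cell_int j c%:P = c * h j.
Proof.
rewrite /cell_int; under eq_Rintegral do rewrite hornerC.
rewrite Rintegral_cst//= lebesgue_measure_itv /= lte_fin left_lt_right.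
by rewrite -EFinD.
Qed.

(** A vanishing integral of the nonnegative function p^2 makes it zero almost everywhere. Were [p]
    nonzero, the cell would be covered by a null set and finitely many roots, against its positive
    length. *)
Lemma cell_int_definite j p : cell_int j (p * p) = 0 -> p = 0.
Proof.
move=> hp; apply/eqP/negP => /negP p0.
pose D := `[left_end j, right_end j]%classic.
have iD := integrable_horner (left_end j) (right_end j) (p * p).
have mf := measurable_int mu iD.
have ipp : (\int[mu]_(x in D) `|(EFin \o horner (p * p)) x| = 0)%E.
  rewrite -[RHS]/(0%:E) -hp fineK; last exact: integrable_fin_num.
  by apply: eq_integral => x _ /=; rewrite hornerM ger0_norm// -expr2 sqr_ge0.
have /(ae_eq_integral_abs mu (measurable_itv _) mf)[N [mN N0 DN]] := ipp.
have ND : mu.-negligible D.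
  apply: (@negligibleS _ _ _ mu (N `|` [set x | root p x])%classic) => [x Dx|].
    have [px|px] := boolP (root p x); [by right|left; apply: DN => /= /(_ Dx)].
    by move=> [] /eqP; rewrite hornerM mulf_eq0 orbb -rootE (negPf px).
  apply: negligibleU; first by exists N; split.
  have rp := finite_set_countable (finite_roots p0).
  apply/negligibleP; last exact: countable_lebesgue_measure0.
  exact: countable_measurable.
move/negligibleP : ND => /(_ (measurable_itv _)).
move/eqP; rewrite /D /= lebesgue_measure_itv/= lte_fin left_lt_right.
by rewrite -EFinD eqe gt_eqF// h_gt0.
Qed.
End Cells.

(** * Piecewise polynomials *)

(** At infinite [x] both sides are 0, since a nonzero factor keeps [x] infinite and [fine] sends
    infinities to 0. The norm can thus be scaled without a proof that it is finite. *)
Lemma fineZ (R : realType) (a : R) (x : \bar R) :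
  a != 0 -> fine (a%:E * x)%E = a * fine x.
Proof.
move=> a0; case: x => [r| |]; first by [].
- by rewrite mulr0 mulr_infty; case: sgrP a0; rewrite ?eqxx ?mul1e ?mulN1e.
- by rewrite mulr0 mulr_infty; case: sgrP a0; rewrite ?eqxx ?mul1e ?mulN1e.
Qed.

Section DGFunctions.
Context {R : realType} (M : mesh R).
Local Notation cell := 'I_(ncells M).
Local Notation mu := (@lebesgue_measure R).
Implicit Types (j : cell) (k : nat).

Lemma dg_cstE k c j : dg_cst M k c j = c%:P :> {poly R}.
Proof. by rewrite ffunE npolypK// size_polyC; case: eqP. Qed.

Lemma dg_addE k (u v : dgfun M k) j :
  (u + v) j = (u j : {poly R}) + v j :> {poly R}.
Proof. by rewrite ffunE. Qed.

Lemma dg_scaleE k (a : R) (u : dgfun M k) j :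
  (a *: u) j = a *: (u j : {poly R}) :> {poly R}.
Proof. by rewrite ffunE. Qed.

Lemma dgfunP k (u v : dgfun M k) :
  (forall j, u j = v j :> {poly R}) -> u = v.
Proof. by move=> uv; apply/ffunP => j; exact/val_inj/uv. Qed.

Lemma node_le m n : (m <= n <= ncells M)%N -> node M m <= node M n.
Proof.
elim: n => [|n IHn]; first by rewrite leqn0 => /andP[/eqP ->].
case/andP; rewrite leq_eqVlt => /predU1P[-> //|mn nM].
by rewrite (le_trans (IHn _))// ?ltW ?node_lt// -ltnS mn ltnW.
Qed.

Definition cell_indic j : R -> R := \1_(`[left_end j, right_end j[%classic).

(** Half-open cells are disjoint even at the nodes, so this holds at every point and not merely
    almost everywhere. *)
Lemma cell_indicM i j x :
  cell_indic i x * cell_indic j x = (i == j)%:R * cell_indic j x.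
Proof.
have disj (l m : cell) : (l < m)%N -> cell_indic l x * cell_indic m x = 0.
  move=> lm; rewrite /cell_indic !indicE -natrM mulnb.
  case: andP => [[/set_mem + /set_mem]|//].
  rewrite /= !in_itv /= => /andP[_ xl] /andP[mx _].
  have := @node_le l.+1 m; rewrite lm ltnW//= => /(_ isT).
  by move/(lt_le_trans xl)/lt_le_trans/(_ mx); rewrite ltxx.
case: (ltngtP i j) => [ij|ji|/val_inj ->].
- by rewrite disj// -val_eqE/= ltn_eqF// mul0r.
- by rewrite mulrC disj// -val_eqE/= gtn_eqF// mul0r.
by rewrite eqxx mul1r /cell_indic !indicE -natrM mulnb andbb.
Qed.

Lemma Rintegral_cells (p : cell -> {poly R}) :
  (\int[mu]_(x in domain M) \sum_j cell_indic j x * (p j).[x])%R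
  = \sum_j cell_int j (p j).
Proof.
pose A j := `[left_end j, right_end j[%classic.
have AE j x : cell_indic j x * (p j).[x] = (horner (p j) \_ (A j)) x.
  by rewrite patch_indic mulrC.
have sA j : (A j `<=` domain M)%classic.
  move=> x; rewrite /A /domain /= !in_itv /= => /andP[lx xr].
  have l0 : node M 0 <= left_end j by rewrite node_le//= ltnW.
  have rN : right_end j <= node M (ncells M) by rewrite node_le// leqnn andbT.
  by rewrite (le_trans l0 lx) (le_trans (ltW xr) rN).
have mA j : measurable (A j : set (measurableTypeR R)) by exact: measurable_itv.
have mD : measurable (domain M : set (measurableTypeR R)).
  exact: measurable_itv.
have iA j : mu.-integrable (A j) (EFin \o horner (p j)).
  have iA' := integrable_horner (left_end j) (right_end j) (p j).
  apply: integrableS iA'; [exact: measurable_itv|exact: measurable_itv|].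
  by move=> x; rewrite /A /= !in_itv /= => /andP[-> /ltW].
have iD j : mu.-integrable (domain M) (EFin \o (horner (p j) \_ (A j))).
  rewrite -restrict_EFin; apply/integrable_restrict; [exact: mA|exact: mD|].
  by rewrite setIidr.
rewrite /Rintegral.
under eq_integral do rewrite (eq_bigr _ (fun j _ => AE j _)) -sumEFin.
rewrite integral_sum// -sum_fine => [|j _]; last first.
  exact: (integrable_fin_num mD (iD j)).
apply: eq_bigr => j _.
rewrite -[LHS]/(Rintegral _ _ _) -Rintegral_mkcondr setIidr//.
(* The half-open cell used by [dg_eval] and the closed one used by [cell_int] differ by a single
   point. *)
exact: (Rintegral_itv_bndo_bndc (iA j)).
Qed.

Lemma dg_evalE k (v : dgfun M k) x :
  dg_eval v x = \sum_j cell_indic j x * (v j : {poly R}).[x].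
Proof. by []. Qed.

Lemma dg_evalZ k (a x : R) (v : dgfun M k) :
  dg_eval (a *: v) x = a * dg_eval v x.
Proof.
rewrite !dg_evalE mulr_sumr; apply: eq_bigr => j _.
by rewrite dg_scaleE hornerZ mulrCA.
Qed.

Lemma avgE k (v : dgfun M k) :
  avg v = (\sum_j cell_int j (v j)) / (node M (ncells M) - node M 0).
Proof.
rewrite /avg; under eq_Rintegral do rewrite dg_evalE.
by rewrite Rintegral_cells.
Qed.

Lemma sum_h : \sum_(j < ncells M) h j = node M (ncells M) - node M 0.
Proof.
rewrite -(telescope_sumr (node M))// big_mkord; exact: eq_bigr.
Qed.

Lemma avg_affine k (a c : R) (v : dgfun M k) :
  avg (a *: v + dg_cst M k c) = a * avg v + c.
Proof.
rewrite !avgE.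
under eq_bigr do rewrite dg_addE dg_scaleE dg_cstE linearP /= cell_intC.
rewrite big_split /= -!mulr_sumr sum_h mulrDl -mulrA mulfK//.
rewrite subr_eq0 gt_eqF//; have n0 := ncells_gt0 M.
by rewrite (lt_le_trans (node_lt n0))// node_le// n0 leqnn.
Qed.

Lemma cell_avg_affine k (a c : R) (v : dgfun M k) j :
  cell_avg (a *: v + dg_cst M k c) j = a * cell_avg v j + c.
Proof.
rewrite /cell_avg dg_addE dg_scaleE dg_cstE linearP /= cell_intC mulrDl mulrA.
by rewrite mulfK// gt_eqF// h_gt0.
Qed.

Lemma Linfty_normZ k (a : R) (v : dgfun M k) : a != 0 ->
  Linfty_norm (a *: v) = `|a| * Linfty_norm v.
Proof.
move=> a0; rewrite /Linfty_norm unlock.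
(* The norm unfolds to an essential supremum if the whole space has positive measure and to 0
   otherwise. *)
case: ifPn => [_|]; last by rewrite mulr0.
rewrite (_ : _ \o _ = (cst `|a|%:E \* (abse \o (EFin \o dg_eval v)))%E).
  rewrite ess_sup_pZl ?normr_gt0//.
  by rewrite fineZ// normr_eq0.
apply/funext => x /=.
by rewrite dg_evalZ normrM EFinM.
Qed.

End DGFunctions.

(** * L^2 projection and damping coefficients *)

Section Proj.
Context {R : realType} (M : mesh R).
Local Notation cell := 'I_(ncells M).
Local Notation mu := (@lebesgue_measure R).
Implicit Types (j : cell) (k : nat).

(** Products of pieces from different cells vanish, so orthogonality over the domain becomes a sum
    of cell integrals. *)
Lemma is_L2projE k m (v : dgfun M k) (q : dgfun M m) :
  is_L2proj v q <-> forall w : dgfun M m,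
    \sum_j cell_int j (((v j : {poly R}) - q j) * w j) = 0.
Proof.
suff E (w : dgfun M m) :
    (\int[mu]_(x in domain M) ((dg_eval v x - dg_eval q x) * dg_eval w x))%R =
    \sum_j cell_int j (((v j : {poly R}) - q j) * w j).
  by split=> h w; [rewrite -E|rewrite E].
rewrite -Rintegral_cells; apply: eq_Rintegral => x _.
rewrite !dg_evalE -sumrB mulr_suml; apply: eq_bigr => i _.
rewrite -mulrBr -hornerN -hornerD mulr_sumr (bigD1 i)//= mulrACA.
rewrite cell_indicM eqxx mul1r -hornerM big1 ?addr0// => l li.
by rewrite mulrACA cell_indicM eq_sym (negPf li) mul0r mul0r.
Qed.

(** The truncation satisfies the condition that defines the projection and is the only function to
    do so; [xget] must therefore return it. *)
Lemma L2projE k m (v : dgfun M k) j :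
  L2proj m v j = trunc (cell_int j) m.+1 (v j) :> {poly R}.
Proof.
pose q0 : dgfun M m := [ffun l => npolyp m.+1 (trunc (cell_int l) m.+1 (v l))].
have q0E l : q0 l = trunc (cell_int l) m.+1 (v l) :> {poly R}.
  by rewrite ffunE npolypK// size_trunc.
rewrite -q0E; suff -> : L2proj m v = q0 by []; apply: xget_unique.
  apply/is_L2projE => w; rewrite big1// => l _.
  apply: (orthogonal_low_degree (@cell_int_definite _ _ l) (size_npoly (w l))).
  move=> i im; rewrite mulrBl linearB /= q0E trunc_orthopoly ?subrr//.
  exact: cell_int_definite.
move=> q /is_L2projE hq; apply: dgfunP => l; rewrite q0E.
apply: (eq_orthopoly (@cell_int_definite _ _ l) (size_npoly _)) => [|i im].
  exact: size_trunc.
rewrite trunc_orthopoly//; last exact: cell_int_definite.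
apply/eqP; rewrite eq_sym -subr_eq0 -linearB -mulrBl /=.
(* A test function supported on cell [l] isolates that cell in the sum. *)
pose w : dgfun M m :=
  [ffun l' => if l' == l then npolyp m.+1 (orthopoly (cell_int l) i) else 0].
have := hq w; rewrite (bigD1 l)//= big1 => [|l' ll'].
  by rewrite addr0 ffunE eqxx npolypK ?size_orthopoly// => ->.
by rewrite ffunE (negPf ll') mulr0 linear0.
Qed.

End Proj.

Section Sigma.
Context {R : realType} (M : mesh R) (bc : boundary).
Local Notation cell := 'I_(ncells M).
Implicit Types (j : cell) (k : nat).

Lemma jump_affine k (a c : R) (u : dgfun M k) m l r :
  jump (a *: u + dg_cst M k c) m l r = a * jump u m l r.
Proof.
rewrite /jump !dg_addE !dg_scaleE !dg_cstE !derivnD !derivnZ !hornerE.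
rewrite !derivnC; case: (m == 0)%N; rewrite !hornerE; ring.
Qed.

Lemma sigma_affine k (a c : R) (u : dgfun M k) m j : a != 0 ->
  sigma bc (a *: u + dg_cst M k c) m j = sigma bc u m j.
Proof.
move=> a0; rewrite /sigma avg_affine.
have cstE : dg_cst M k (a * avg u + c) = a *: dg_cst M k (avg u) + dg_cst M k c.
  apply: dgfunP => l.
  by rewrite dg_addE dg_scaleE !dg_cstE polyCD polyCM mul_polyC.
(* The affine map is injective, so the test for a constant datum has the same outcome on both
   sides. *)
rewrite cstE (inj_eq (addIr _)) (inj_eq (scalerI a0)) opprD addrACA subrr addr0.
rewrite -scalerBr Linfty_normZ//; case: ifPn => // _; congr (_ * _).
have -> : jump_left bc (a *: u + dg_cst M k c) m j = a * jump_left bc u m j.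
  rewrite /jump_left; case: bc; rewrite jump_affine//.
  by case: ifP; rewrite ?mulr0.
have -> : jump_right bc (a *: u + dg_cst M k c) m j = a * jump_right bc u m j.
  rewrite /jump_right; case: bc; rewrite jump_affine//.
  by case: ifP; rewrite ?mulr0.
(* Only the common factor [|a|] is cancelled; nothing is asked of the norm in the denominator. *)
rewrite !normrM -mulrDr mulrCA -mulf_div divff ?mul1r//.
by rewrite normr_eq0.
Qed.
End Sigma.

(** * The damping problem *)

Lemma is_derive_mulrl (R : realType) (a t : R) : is_derive t (1 : R) ( *%R a) a.
Proof.
have := is_deriveZ a (is_derive_id t (1 : R)).
by rewrite [_ *: 1]mulr1.
Qed.

Lemma is_derive_expRM (R : realType) (a t : R) :
  is_derive t (1 : R) (fun s => expR (a * s)) (a * expR (a * t)).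
Proof.
rewrite [a * expR _]mulrC.
exact: is_derive1_comp (is_derive_expR _) (is_derive_mulrl a t).
Qed.

(** The integrating factor exp(-at) makes the derivative of [g] vanish on the open interval; the
    mean value theorem then gives equal values of [g] at the two end points. *)
Lemma linear_ode_unique (R : realType) (phi : R -> R) (a tau : R) : 0 < tau ->
  ({within `[0, tau], continuous phi})%classic ->
  (forall t, 0 < t < tau -> is_derive t (1 : R) phi (a * phi t)) ->
  phi tau = expR (a * tau) * phi 0.
Proof.
move=> tau0 cphi dphi.
pose g t := expR (- a * t) * phi t.
have dg t : t \in `]0, tau[ -> is_derive t (1 : R) g 0.
  rewrite in_itv /= => /dphi dphit.
  apply: is_derive_eq (is_deriveM (is_derive_expRM (- a) t) dphit) _.
  by rewrite /GRing.scale /=; ring.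
have cg : ({within `[0, tau], continuous g})%classic.
  move=> t; apply: cvgM; last exact: cphi.
  apply: continuous_subspaceT => s; apply: differentiable_continuous.
  by apply/derivable1_diffP; case: (is_derive_expRM (- a) s).
have [c _] := MVT tau0 dg cg.
rewrite mul0r /g mulr0 expR0 mul1r => /eqP; rewrite subr_eq0 => /eqP <-.
by rewrite mulrA -expRD mulNr subrr expR0 mul1r.
Qed.

Section Damping.
Context {R : realType} (M : mesh R) (bc : boundary).
Local Notation cell := 'I_(ncells M).
Implicit Types (j : cell) (k : nat).

(** The filter selects those [m] whose projection discards mode [i]. It admits no [m] when [i] is 0,
    and treats [m = 0] like [m = 1], as the convention for P^{-1} requires. *)
Definition decay_rate k (beta : cell -> R) (u : dgfun M k) j i : R :=
  \sum_(0 <= m < k.+1 | (m.-1 < i)%N) beta j * (sigma bc u m j / h j).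

(** The residual of each projection is the sum of the modes above [m.-1]; exchanging the two sums
    collects the coefficients acting on each mode. *)
Lemma damping_modes k (c : nat -> R) j (p q : {poly R}) : (size p <= k.+1)%N ->
  \sum_(0 <= m < k.+1) c m * cell_int j ((p - trunc (cell_int j) m.-1.+1 p) * q)
  = \sum_(i < k.+1) (\sum_(0 <= m < k.+1 | (m.-1 < i)%N) c m)
                    * cell_int j (mode (cell_int j) i p * q).
Proof.
move=> sp.
transitivity (\sum_(0 <= m < k.+1) \sum_(i < k.+1)
    if (m.-1 < i)%N then c m * cell_int j (mode (cell_int j) i p * q) else 0).
  apply: eq_big_nat => m /andP[_ mk].
  (* The number of modes kept is [m], except that one is kept when [m] is 0. *)
  have mk' : (m.-1.+1 <= k.+1)%N by case: m mk => // m /ltnW.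
  rewrite -{1}(trunc_id (@cell_int_definite _ _ j) sp) /trunc.
  rewrite (big_ord_widen k.+1 (fun i => mode (cell_int j) i p) mk').
  rewrite (bigID (fun i : 'I_k.+1 => (i < m.-1.+1)%N))/= addrC addrK.
  rewrite mulr_suml linear_sum mulr_sumr big_mkcond /=.
  by apply: eq_bigr => i _; rewrite -ltnNge.
rewrite exchange_big /=; apply: eq_bigr => i _.
by rewrite mulr_suml [RHS]big_mkcond.
Qed.

(** Taking [orthopoly i] as test function leaves a scalar linear equation for the i-th moment of any
    solution. *)
Lemma OE_solution_mode k beta tau (u : dgfun M k) us j i :
  0 < tau -> (i <= k)%N -> OE_solution bc beta tau u us ->
  cell_int j ((us tau j : {poly R}) * orthopoly (cell_int j) i) =
  expR (- decay_rate beta u j i * tau)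
  * cell_int j ((u j : {poly R}) * orthopoly (cell_int j) i).
Proof.
move=> tau0 ik [us0 us_ode].
have [] := us_ode j (npolyp k.+1 (orthopoly (cell_int j) i)).
rewrite npolypK ?size_orthopoly// -us0 => cphi dphi.
apply: (linear_ode_unique tau0 cphi) => t /dphi dphit.
apply: is_derive_eq dphit _.
under eq_bigr do rewrite L2projE.
rewrite damping_modes ?size_npoly// us0 mulNr; congr (- _).
rewrite (bigD1 (Ordinal (ik : (i < k.+1)%N)))//=.
rewrite [X in _ + X]big1 ?addr0 => [|l li].
  by rewrite mode_orthopoly//; exact: cell_int_definite.
by rewrite mode_orthogonal ?mulr0//; exact: cell_int_definite.
Qed.

Definition damped k (beta : cell -> R) (u : dgfun M k) (t : R) : dgfun M k :=
  [ffun j => npolyp k.+1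
    (\sum_(i < k.+1) expR (- decay_rate beta u j i * t)
                      *: mode (cell_int j) i (u j))].

Lemma dampedE k beta (u : dgfun M k) t j :
  damped beta u t j = \sum_(i < k.+1) expR (- decay_rate beta u j i * t)
                        *: mode (cell_int j) i (u j) :> {poly R}.
Proof.
rewrite ffunE npolypK//.
exact: (size_sum_mode _ _ (fun i => expR (- decay_rate beta u j i * t))).
Qed.

Lemma damped_orthopoly k beta (u : dgfun M k) t j i : (i <= k)%N ->
  cell_int j ((damped beta u t j : {poly R}) * orthopoly (cell_int j) i) =
  expR (- decay_rate beta u j i * t)
  * cell_int j ((u j : {poly R}) * orthopoly (cell_int j) i).
Proof.
move=> ik; rewrite dampedE.
pose c i := expR (- decay_rate beta u j i * t).
by rewrite (sum_mode_orthopoly (@cell_int_definite _ _ j) _ c) ltnS ik.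
Qed.

Lemma mode_damped k beta (u : dgfun M k) t j i : (i <= k)%N ->
  mode (cell_int j) i (damped beta u t j) =
  expR (- decay_rate beta u j i * t) *: mode (cell_int j) i (u j).
Proof.
move=> ik.
by rewrite /mode /proj_along /= damped_orthopoly// scalerA mulrA.
Qed.

(** Existence has to be shown because [OE] would fall back on its default value 0 if the problem had
    no solution. *)
Lemma damped_solution k beta tau (u : dgfun M k) :
  OE_solution bc beta tau u (damped beta u).
Proof.
split=> [|j v].
  apply: dgfunP => j; rewrite dampedE.
  rewrite -[RHS](trunc_id (@cell_int_definite _ _ j) (size_npoly _)).
  by apply: eq_bigr => i _; rewrite mulr0 expR0 scale1r.
(* Tested against [v], the candidate is a finite sum of exponentials in time, so it can be
   differentiated term by term. *)
have E : (fun t => cell_int j ((damped beta u t j : {poly R}) * v)) =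
    \sum_(i < k.+1) (fun t => expR (- decay_rate beta u j i * t)
                              * cell_int j (mode (cell_int j) i (u j) * v)).
  apply/funext => t; rewrite dampedE mulr_suml linear_sum fct_sumE.
  by apply: eq_bigr => i _; rewrite -scalerAl linearZ.
have d t : is_derive t (1 : R)
    (fun t => cell_int j ((damped beta u t j : {poly R}) * v))
    (\sum_(i < k.+1) (- decay_rate beta u j i) *
       (expR (- decay_rate beta u j i * t)
        * cell_int j (mode (cell_int j) i (u j) * v))).
  rewrite E; apply: is_derive_sum => i.
  set b := cell_int j _; rewrite mulrA [_ * b]mulrC.
  rewrite (_ : (fun _ => _) =
      b \*: (fun t => expR (- decay_rate beta u j i * t))).
    exact/is_deriveZ/is_derive_expRM.
  by apply/funext => s; rewrite /= mulrC.
split.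
  apply: continuous_subspaceT => t; apply: differentiable_continuous.
  by apply/derivable1_diffP; case: (d t).
move=> t _; apply: is_derive_eq.
under [in RHS]eq_bigr do rewrite L2projE.
rewrite damping_modes ?size_npoly// -sumrN; apply: eq_bigr => i _.
rewrite mode_damped ?mulNr -1?ltnS//; congr (- (_ * _)).
by rewrite -[in RHS]scalerAl [RHS]linearZ.
Qed.

(** Any solution has the moments of [damped] at time [tau], and on each cell the moments of index up
    to [k] determine a polynomial of degree at most [k]. *)
Lemma OE_damped k beta tau (u : dgfun M k) : 0 < tau ->
  OE bc beta tau u = damped beta u tau.
Proof.
move=> tau0; apply: xget_unique.
  by exists (damped beta u) => //; exact: damped_solution.
move=> w [us us_sol <-]; apply: dgfunP => j.
apply: (eq_orthopoly (@cell_int_definite _ _ j) (size_npoly _) (size_npoly _)).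
move=> i ik /=.
by rewrite (OE_solution_mode _ tau0 _ us_sol)// damped_orthopoly.
Qed.

Lemma damped_affine k beta (a c t : R) (u : dgfun M k) : a != 0 ->
  damped beta (a *: u + dg_cst M k c) t = a *: damped beta u t + dg_cst M k c.
Proof.
move=> a0; apply: dgfunP => j.
rewrite dg_addE dg_scaleE dg_cstE !dampedE dg_addE dg_scaleE dg_cstE.
have rateE i :
    decay_rate beta (a *: u + dg_cst M k c) j i = decay_rate beta u j i.
  by apply: eq_bigr => m _; rewrite sigma_affine.
have sc : (size c%:P <= 1)%N by rewrite size_polyC; case: eqP.
(* The constant [c] lies entirely in mode 0, the only mode that is never damped. *)
have mode0 : mode (cell_int j) 0 c%:P = c%:P.
  have := trunc_id (@cell_int_definite _ _ j) sc.
  by rewrite /trunc big_ord1.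
have modeP i : mode (cell_int j) i (a *: (u j : {poly R}) + c%:P) =
    a *: mode (cell_int j) i (u j) + mode (cell_int j) i c%:P.
  exact: mode_is_linear.
have rate0 : decay_rate beta u j 0 = 0 by rewrite /decay_rate big1.
rewrite !big_ord_recl !rateE rate0 oppr0 mul0r expR0 !scale1r modeP mode0.
rewrite scalerDr -!addrA; congr (_ + _); rewrite addrC; congr (_ + _).
rewrite scaler_sumr; apply: eq_bigr => i _.
have modec : mode (cell_int j) (lift ord0 i) c%:P = 0.
  apply: (mode_low_degree (@cell_int_definite _ _ j)).
  exact: leq_trans sc _.
by rewrite rateE modeP modec addr0 !scalerA [_ * a]mulrC.
Qed.

End Damping.

(** * Wave speeds under the affine change of flux, and the theorem *)

Lemma wave_speed_affine (R : realType) (M : mesh R) k (f : R -> R) (a c : R)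
    (u : dgfun M k) j : a != 0 -> (forall w, derivable f w 1) ->
  wave_speed (affine_flux a c f) (a *: u + dg_cst M k c) j = wave_speed f u j.
Proof.
move=> a0 df; rewrite /wave_speed cell_avg_affine; congr `|_|.
set x := cell_avg u j.
have g : is_derive (a * x + c) (1 : R) (fun w => a^-1 * (w - c)) a^-1.
  have := is_derive1_comp (is_derive_mulrl a^-1 _)
    (is_derive_shift (a * x + c) 1 (- c)).
  by rewrite mulr1.
(* The inner map of the flux sends the new cell average back to [x]. In the chain rule its slope
   [a^-1] then cancels the outer factor [a]. *)
have gx : a^-1 * (a * x + c - c) = x by rewrite addrK mulKf.
have /derivableP dfx := df x.
have := dfx; rewrite -{1}gx => dfgx.
have [_] := is_deriveZ a
  (@is_derive1_comp _ f (fun w => a^-1 * (w - c)) _ _ _ dfgx g).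
have -> : affine_flux a c f = a \*: (f \o (fun w => a^-1 * (w - c))).
  by apply/funext => w; rewrite /affine_flux [X in f X]mulrC.
by rewrite !derive1E => ->; rewrite [_ *: _]mulrCA divff// mulr1.
Qed.

(** The affine map moves the cell averages, so a fixed flux need not give the same wave speeds for
    both data. Hence the commutation is stated for prescribed speeds, for a flux whose speeds agree
    on both data, and for the flux transformed with the solution. In the last two cases the speeds
    coincide, which reduces them to the first. *)
Theorem theorem2p6 (R : realType) (M : mesh R) (bc : boundary) (k : nat)
    (u : dgfun M k) (lam mu : R) (hlam : lam != 0) :
  (forall (m : nat) (j : 'I_(ncells M)), (m <= k)%N ->
     sigma bc (lam *: u + dg_cst M k mu) m j = sigma bc u m j)
  /\
  (* the local wave speeds being held fixed *)
  (forall (beta : 'I_(ncells M) -> R) (tau : R),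
     (forall j, 0 <= beta j) -> 0 < tau ->
     OE bc beta tau (lam *: u + dg_cst M k mu)
     = lam *: OE bc beta tau u + dg_cst M k mu)
  /\
  (* local wave speeds |f'(cell average)|, same flux *)
  (forall (f : R -> R) (tau : R),
     (forall w, derivable f w 1) -> 0 < tau ->
     (forall j, wave_speed f (lam *: u + dg_cst M k mu) j
                = wave_speed f u j) ->
     OE_flux bc f tau (lam *: u + dg_cst M k mu)
     = lam *: OE_flux bc f tau u + dg_cst M k mu)
  /\
  (* local wave speeds |f'(cell average)|, flux transformed with the solution *)
  (forall (f : R -> R) (tau : R),
     (forall w, derivable f w 1) -> 0 < tau ->
     OE_flux bc (affine_flux lam mu f) tau (lam *: u + dg_cst M k mu)
     = lam *: OE_flux bc f tau u + dg_cst M k mu).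
Proof.
have OE_affine beta tau : 0 < tau -> OE bc beta tau (lam *: u + dg_cst M k mu)
     = lam *: OE bc beta tau u + dg_cst M k mu.
  by move=> tau0; rewrite !OE_damped// damped_affine.
split; first by move=> m j _; exact: sigma_affine.
split; first by move=> beta tau _; exact: OE_affine.
split=> f tau df tau0 => [wE|].
  by rewrite /OE_flux (funext wE) OE_affine.
have wE j : wave_speed (affine_flux lam mu f) (lam *: u + dg_cst M k mu) j =
    wave_speed f u j by exact: wave_speed_affine.
by rewrite /OE_flux (funext wE) OE_affine.
Qed.
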